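(* Let $a>0$. Then $\mathfrak{C}(\mathbb{R}\times a\mathbb{Z})$ is dense in $L^2(\mathbb{R})$.
   Context: The Gabor transform of $f\in L^2(\mathbb{R})$ is $$\mathcal{G}f(x,\omega)=2^{1/4}\int_{\mathbb{R}}f(t)\,\mathrm{e}^{-\pi(t-x)^2}\mathrm{e}^{-2\pi\mathrm{i}t\omega}\,\mathrm{d}t,\qquad (x,\omega)\in\mathbb{R}^2.$$ Here $L^2(\mathbb{R})$ consists of complex-valued functions. Write $f\sim g$ if there is $\alpha\in\mathbb{R}$ with $f=\mathrm{e}^{\mathrm{i}\alpha}g$. For $\Lambda\subset\mathbb{R}^2$, the class of counterexamples for sampled Gabor phase retrieval on $\Lambda$ is $$\mathfrak{C}(\Lambda)=\{f\in L^2(\mathbb{R}):\exists\,g\in L^2(\mathbb{R})\text{ such that } f\not\sim g\text{ and }|\mathcal{G}f|=|\mathcal{G}g|\text{ on }\Lambda\}.$$ *)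

(* Defs.v *)
From mathcomp Require Import all_boot all_order all_algebra.
From mathcomp Require Import all_classical all_reals all_analysis.
From mathcomp Require Export complex.

Set Implicit Arguments.
Unset Strict Implicit.
Unset Printing Implicit Defensive.

Import Order.TTheory GRing.Theory Num.Theory.

Local Open Scope classical_set_scope.
Local Open Scope ring_scope.

Definition cexpi (R : realType) (x : R) : R[i] := (cos x +i* sin x)%C.

(* Total operator: it is the Lebesgue integral of f only when the real and
   imaginary parts of f are integrable (otherwise the value is meaningless). *)
Definition cintegral (R : realType) (f : R -> R[i]) : R[i] :=
  ((\int[lebesgue_measure]_t complex.Re (f t)) +i*
   (\int[lebesgue_measure]_t complex.Im (f t)))%C.

Definition L2norm (R : realType) (f : R -> R[i]) : \bar R :=
  Lnorm lebesgue_measure 2%:E (fun t => (Normc.normc (f t))%:E).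

(* Elements of the space L^2(R) are represented by functions; two
   representatives are to be identified when they are equal almost everywhere,
   which is why [phase_equiv] below is an almost-everywhere relation. *)
Definition L2 (R : realType) : set (R -> R[i]) :=
  [set f | [/\ measurable_fun [set: R] (fun t => complex.Re (f t)),
               measurable_fun [set: R] (fun t => complex.Im (f t)) &
               (L2norm f < +oo)%E]].

(* The integrand is integrable for f in L2, as the product of f with a
   function that is itself square integrable. *)
Definition gabor (R : realType) (f : R -> R[i]) (z : R * R) : R[i] :=
  ((2 `^ 4^-1)%:C)%C *
  cintegral (fun t => f t * ((expR (- pi * (t - z.1) ^+ 2))%:C)%C
                          * cexpi (- 2 * pi * t * z.2)).

Definition phase_equiv (R : realType) (f g : R -> R[i]) : Prop :=
  exists alpha : R, f = (fun t => cexpi alpha * g t) %[ae lebesgue_measure].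

Definition counterexamples (R : realType) (Lambda : set (R * R)) :
    set (R -> R[i]) :=
  [set f | L2 f /\
     exists g : R -> R[i],
       [/\ L2 g, ~ phase_equiv f g &
           forall z, Lambda z ->
             Normc.normc (gabor f z) = Normc.normc (gabor g z)]].

Definition dense_in_L2 (R : realType) (A : set (R -> R[i])) : Prop :=
  forall f : R -> R[i], L2 f -> forall e : R, 0 < e ->
    exists2 h, A h & (L2norm (fun t => f t - h t)%R < e%:E)%E.

(* Main.v *)
(* Put s = 1/a and (T f)(t) = e^(2 pi s t) f(t - s); on the Bargmann side T is
   the multiplication by an exponential.  Completing the square gives
     G(T f)(x, w) = e^(pi s^2 + 2 pi s x) e^(-2 pi i s w) G f(x, w),
   so for w in aZ the factor is a positive real r and
     |G(f + i eps T f)| = |1 + i eps r| |G f| = |1 - i eps r| |G f|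
                        = |G(f - i eps T f)|.
   Any function is close to some f bounded with compact support, and then to
   f + i eps T f for small eps.  To make f + i eps T f and f - i eps T f
   inequivalent, f is also given the constant value eps on n < |t| <= n + s,
   beyond which it vanishes: just left of -n, T f = 0 forces the phase 1, and on
   the right of n + s, f = 0 forces the phase -1. *)
Require Import Defs.
From mathcomp Require Import all_boot all_order all_algebra.
From mathcomp Require Import all_classical all_reals all_analysis.
From mathcomp Require Import measurable_realfun ring lra.

Import Order.TTheory GRing.Theory Num.Theory.
Import Normc.

Local Open Scope classical_set_scope.
Local Open Scope ring_scope.

Section complex_functions.
Context {R : realType}.
Implicit Types (f g k : R -> R[i]) (M N s : R).
Local Notation mu := (@lebesgue_measure R).
Local Notation Re := (@complex.Re R).
Local Notation Im := (@complex.Im R).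

(** * Arithmetic and modulus of complex numbers, and the phase factor [cexpi] *)

Lemma ReM (x y : R[i]) : Re (x * y) = Re x * Re y - Im x * Im y.
Proof. by case: x y => [? ?] [? ?]. Qed.

Lemma ImM (x y : R[i]) : Im (x * y) = Re x * Im y + Im x * Re y.
Proof. by case: x y => [? ?] [? ?]. Qed.

Lemma ReD (x y : R[i]) : Re (x + y) = Re x + Re y.
Proof. by case: x y => [? ?] [? ?]. Qed.

Lemma ImD (x y : R[i]) : Im (x + y) = Im x + Im y.
Proof. by case: x y => [? ?] [? ?]. Qed.

Lemma normc_ge0 (z : R[i]) : 0 <= normc z.
Proof. by case: z => x y; exact: sqrtr_ge0. Qed.

Lemma sqr_normcE (z : R[i]) : normc z ^+ 2 = Re z ^+ 2 + Im z ^+ 2.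
Proof. by case: z => x y /=; rewrite sqr_sqrtr// addr_ge0// sqr_ge0. Qed.

Lemma normr_Re_le (z : R[i]) : `|Re z| <= normc z.
Proof.
by rewrite -ler_sqr ?nnegrE ?normc_ge0// sqr_normcE real_normK ?num_real// lerDl sqr_ge0.
Qed.

Lemma normr_Im_le (z : R[i]) : `|Im z| <= normc z.
Proof.
by rewrite -ler_sqr ?nnegrE ?normc_ge0// sqr_normcE real_normK ?num_real// lerDr sqr_ge0.
Qed.

Lemma normc_real (x : R) : normc x%:C%C = `|x|.
Proof. by rewrite /= expr0n addr0 sqrtr_sqr. Qed.

Lemma normc_cexpi (x : R) : normc (cexpi x) = 1.
Proof. by rewrite /= cos2Dsin2 sqrtr1. Qed.

Lemma cexpiD (x y : R) : cexpi (x + y) = cexpi x * cexpi y.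
Proof.
rewrite /cexpi cosD sinD; congr Complex.
by rewrite addrC (mulrC (cos x)).
Qed.

Lemma cexpi_int (k : int) : cexpi (2 * pi * k%:~R) = 1 :> R[i].
Proof.
have nat_case (n : nat) : cexpi (2 * pi * n%:R) = 1 :> R[i].
  rewrite /cexpi mulr_natr mulr_natl.
  elim: n => [|n IHn]; first by rewrite mulr0n cos0 sin0.
  by rewrite mulrSr cosD2pi sinD2pi.
case: k => n; first exact: nat_case.
rewrite NegzE mulrNz mulrN.
(* Negative multiples follow from positive ones, since cexpi(-x) cexpi(x) = cexpi(0) = 1. *)
have := cexpiD (- (2 * pi * n.+1%:R)) (2 * pi * n.+1%:R).
by rewrite addNr nat_case mulr1 {1}/cexpi cos0 sin0.
Qed.

(** * Measurability of complex-valued functions *)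

Definition cmeasurable f := measurable_fun [set: R] (fun t => Re (f t)) /\
  measurable_fun [set: R] (fun t => Im (f t)).

Lemma cmeasurable_cst (c : R[i]) : cmeasurable (fun=> c).
Proof. by split; exact: measurable_cst. Qed.

Lemma cmeasurableD {f g} : cmeasurable f -> cmeasurable g ->
  cmeasurable (fun t => f t + g t).
Proof.
move=> [mf1 mf2] [mg1 mg2]; split.
  by under eq_fun do rewrite ReD; exact: measurable_funD.
by under eq_fun do rewrite ImD; exact: measurable_funD.
Qed.

Lemma cmeasurableM {f g} : cmeasurable f -> cmeasurable g ->
  cmeasurable (fun t => f t * g t).
Proof.
move=> [mf1 mf2] [mg1 mg2]; split.
  by under eq_fun do rewrite ReM; apply: measurable_funB; exact: measurable_funM.
by under eq_fun do rewrite ImM; apply: measurable_funD; exact: measurable_funM.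
Qed.

Lemma cmeasurable_real {h : R -> R} : measurable_fun [set: R] h ->
  cmeasurable (fun t => (h t)%:C%C).
Proof. by move=> mh; split => //; exact: measurable_cst. Qed.

Lemma cmeasurable_cexpi {h : R -> R} : measurable_fun [set: R] h ->
  cmeasurable (fun t => cexpi (h t)).
Proof.
move=> mh; split => /=.
  exact: (measurableT_comp (continuous_measurable_fun (@continuous_cos R)) mh).
exact: (measurableT_comp (continuous_measurable_fun (@continuous_sin R)) mh).
Qed.

Lemma cmeasurable_if {f g} {b : R -> bool} : measurable_fun [set: R] b ->
  cmeasurable f -> cmeasurable g -> cmeasurable (fun t => if b t then f t else g t).
Proof.
move=> mb [mf1 mf2] [mg1 mg2]; split.
  by under eq_fun do rewrite fun_if; exact: measurable_fun_ifT.
by under eq_fun do rewrite fun_if; exact: measurable_fun_ifT.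
Qed.

Lemma measurable_addrr s : measurable_fun [set: R] (fun t : R => t - s).
Proof. by apply: measurable_funB => //; exact: measurable_cst. Qed.

Lemma cmeasurable_shift {f} s : cmeasurable f -> cmeasurable (fun t => f (t - s)).
Proof.
move=> [mf1 mf2]; split.
  exact: (measurableT_comp mf1 (measurable_addrr s)).
exact: (measurableT_comp mf2 (measurable_addrr s)).
Qed.

Lemma measurable_normc f : cmeasurable f ->
  measurable_fun [set: R] (fun t => normc (f t)).
Proof.
move=> [mf1 mf2].
have -> : (fun t => normc (f t)) =
    (fun t => Num.sqrt (Re (f t) ^+ 2 + Im (f t) ^+ 2)).
  by apply/funext => t; case: (f t).
have m2 : measurable_fun [set: R] (fun t => Re (f t) ^+ 2 + Im (f t) ^+ 2).
  by apply: measurable_funD; exact: measurable_funX.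
exact: (measurableT_comp (continuous_measurable_fun (@sqrt_continuous R)) m2).
Qed.

(** * Translation invariance of the Lebesgue integral *)

(** Lebesgue measure is determined by its values on half-open intervals, and translation preserves
    their length. *)
Lemma lebesgue_measure_shift s (A : set R) : measurable A ->
  pushforward mu (fun t : measurableTypeR R => t - s : measurableTypeR R) A = mu A.
Proof.
move=> mA; apply/esym/lebesgue_measure_unique => //=.
  exact: measurable_addrr.
move=> _ _ [[a b]] _ <-; rewrite /pushforward.
have -> : (fun t => t - s) @^-1` [set` `]a, b]] = [set` `]a + s, b + s]].
  by apply/seteqP; split => t /=; rewrite !in_itv/= ltrBrDr lerBlDr.
by rewrite !lebesgue_measure_itv/= !lte_fin ltrD2r -!EFinB opprD addrACA subrr addr0.
Qed.

Lemma ge0_integral_shift s (h : R -> \bar R) : measurable_fun [set: R] h ->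
  (forall t, 0 <= h t)%E -> (\int[mu]_t h (t - s)%R = \int[mu]_t h t)%E.
Proof.
move=> mh h0.
have ms : measurable_fun [set: measurableTypeR R]
  (fun t => t - s : measurableTypeR R) := measurable_addrr s.
have := ge0_integral_pushforward ms mu measurableT mh
  (fun t _ => h0 t).
rewrite preimage_setT => <-.
by apply: eq_measure_integral => A mA _; exact: lebesgue_measure_shift.
Qed.

(** The nonnegative case is applied to the positive and the negative part of [h]. *)
Lemma integral_shift s (h : R -> R) : measurable_fun [set: R] h ->
  \int[mu]_t h (t - s) = \int[mu]_t h t.
Proof.
move=> mh; rewrite /Rintegral; congr fine.
have mh' : measurable_fun [set: R] (EFin \o h) by exact/measurable_EFinP.
rewrite [LHS]integralE [RHS]integralE; congr (_ - _)%E.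
  rewrite -[RHS](ge0_integral_shift s _ (measurable_funepos mh') (funepos_ge0 _)).
  by apply: eq_integral => t _; rewrite !funeposE.
rewrite -[RHS](ge0_integral_shift s _ (measurable_funeneg mh') (funeneg_ge0 _)).
by apply: eq_integral => t _; rewrite !funenegE.
Qed.

(** * Bounded functions of bounded support *)

(** The bound [M] and the radius [N] are explicit because the size of the perturbation has to be
    known before [eps] is chosen. *)
Definition bounded_supp M N f := [/\ cmeasurable f, forall t, normc (f t) <= M &
  forall t, N < `|t| -> f t = 0].

Lemma bounded_suppW {M M' N N' f} : M <= M' -> N <= N' -> bounded_supp M N f ->
  bounded_supp M' N' f.
Proof.
move=> MM' NN' [mf fM fN]; split => // t; first exact: le_trans MM'.
by move=> N't; apply: fN; exact: le_lt_trans N't.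
Qed.

Lemma bounded_suppD {M M' N f g} : bounded_supp M N f -> bounded_supp M' N g ->
  bounded_supp (M + M') N (fun t => f t + g t).
Proof.
move=> [mf fM fN] [mg gM gN]; split; first exact: cmeasurableD.
- by move=> t; exact: (le_trans (le_normcD _ _) (lerD (fM t) (gM t))).
- by move=> t Nt; rewrite fN// gN// addr0.
Qed.

Lemma bounded_suppM {K M N k f} : 0 <= K -> cmeasurable k ->
  (forall t, `|t| <= N -> normc (k t) <= K) ->
  bounded_supp M N f -> bounded_supp (K * M) N (fun t => k t * f t).
Proof.
move=> K0 mk kK [mf fM fN]; split; first exact: cmeasurableM.
- move=> t; rewrite normcM; have [Nt|tN] := ltP N `|t|.
    rewrite (fN _ Nt) normc0 mulr0 mulr_ge0//.
    exact: le_trans (normc_ge0 _) (fM t).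
  by rewrite ler_pM ?normc_ge0// kK.
- by move=> t Nt; rewrite fN// mulr0.
Qed.

Lemma bounded_supp_shift {M N f} s : bounded_supp M N f ->
  bounded_supp M (N + `|s|) (fun t => f (t - s)).
Proof.
move=> [mf fM fN]; split => // [|t Nt]; first exact: cmeasurable_shift.
apply: fN; have := ler_normB t s; have := ler_normD (t - s) s.
by rewrite subrK; lra.
Qed.

Lemma lebesgue_measure_symm_itv N : 0 <= N -> mu `[- N, N] = (2 * N)%:E.
Proof.
move=> N0; rewrite lebesgue_measure_itv/= lte_fin.
case: ltP => [_|?]; first by rewrite -EFinB; congr EFin; ring.
(* Here N <= -N, so N = 0 and both sides vanish. *)
by congr EFin; lra.
Qed.

Lemma bounded_supp_integral_sqr {M N f} : 0 <= N -> bounded_supp M N f ->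
  (\int[mu]_t (normc (f t) ^+ 2)%:E <= (M ^+ 2 * (2 * N))%:E)%E.
Proof.
move=> N0 [mf fM fN].
have msq : measurable_fun [set: R] (fun t => (normc (f t) ^+ 2)%:E).
  by apply/measurable_EFinP/measurable_funX; exact: measurable_normc.
have -> : (\int[mu]_t (normc (f t) ^+ 2)%:E =
           \int[mu]_(t in `[(- N)%R, N]) (normc (f t) ^+ 2)%:E)%E.
  rewrite [RHS]integral_mkcond; apply: eq_integral => t _; rewrite patchE.
  case: ifPn => // /negP; rewrite inE/= in_itv/= => tN.
  rewrite fN ?normc0 ?expr0n// ltNge; apply/negP.
  by rewrite ler_norml; exact: tN.
rewrite EFinM -lebesgue_measure_symm_itv// -integral_cst//.
apply: ge0_le_integral => //.
- by move=> t _; rewrite lee_fin sqr_ge0.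
- exact: measurable_funTS.
- by move=> t _; rewrite lee_fin lerXn2r ?nnegrE ?normc_ge0//; exact: le_trans (normc_ge0 _) (fM t).
Qed.

(** * Integrability, and linearity and translation invariance of [cintegral] *)

Definition cintegrable f :=
  mu.-integrable [set: R] (EFin \o (fun t => Re (f t))) /\
  mu.-integrable [set: R] (EFin \o (fun t => Im (f t))).

(** Both parts of [f] are dominated by [M] times the indicator of [-N, N]. *)
Lemma bounded_supp_integrable {M N f} : bounded_supp M N f -> cintegrable f.
Proof.
move=> [mf fM fN].
have dom : mu.-integrable [set: R] (fun t => (M * \1_`[- N, N]%classic t)%:E).
  exact: (integrableZl measurableT M (integrable_indic_itv _ _ _ _)).
have key (h : R -> R) : measurable_fun [set: R] h ->
    (forall t, `|h t| <= normc (f t)) -> mu.-integrable [set: R] (EFin \o h).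
  move=> mh hf; apply: le_integrable dom => //; first exact/measurable_EFinP.
  move=> t _ /=; rewrite lee_fin; apply: le_trans (ler_norm _).
  apply: le_trans (hf t) _; rewrite indicE; case: (boolP (t \in _)).
    by rewrite mulr1.
  move=> /negP; rewrite inE/= in_itv/= => tN.
  rewrite fN ?normc0 ?mulr0// ltNge; apply/negP.
  by rewrite ler_norml; exact: tN.
split; first exact: (key _ mf.1 (fun t => normr_Re_le (f t))).
exact: (key _ mf.2 (fun t => normr_Im_le (f t))).
Qed.

Lemma cintegralD {f g} : cintegrable f -> cintegrable g ->
  cintegral (fun t => f t + g t) = cintegral f + cintegral g.
Proof.
move=> [f1 f2] [g1 g2]; rewrite /cintegral.
under eq_Rintegral do rewrite ReD.
under [X in Complex _ X]eq_Rintegral do rewrite ImD.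
by rewrite !RintegralD.
Qed.

Lemma cintegralZ {f} (c : R[i]) : cintegrable f ->
  cintegral (fun t => c * f t) = c * cintegral f.
Proof.
move=> [f1 f2]; rewrite /cintegral.
have Z (r : R) (h : R -> R) : mu.-integrable [set: R] (EFin \o h) ->
    mu.-integrable [set: R] (EFin \o (fun t => r * h t)).
  by move=> ih; exact: (integrableZl measurableT r ih).
under eq_Rintegral do rewrite ReM.
under [X in Complex _ X]eq_Rintegral do rewrite ImM.
rewrite RintegralB ?RintegralD ?RintegralZl//; try exact: Z.
by case: c.
Qed.

Lemma cintegral_shift {f} s : cmeasurable f ->
  cintegral (fun t => f (t - s)) = cintegral f.
Proof.
move=> [f1 f2]; rewrite /cintegral.
by rewrite (integral_shift s _ f1) (integral_shift s _ f2).
Qed.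

(** * Squared norms and approximation by truncation *)

(** Estimates are made on the squared norm, free of roots; [L2normE] links them to [L2norm]. *)
Definition sqnorm f : \bar R := (\int[mu]_t (normc (f t) ^+ 2)%:E)%E.

Lemma measurable_sqr_normc {f} : cmeasurable f ->
  measurable_fun [set: R] (fun t => (normc (f t) ^+ 2)%:E).
Proof.
by move=> mf; apply/measurable_EFinP/measurable_funX; exact: measurable_normc.
Qed.

Lemma sqnorm_ge0 f : (0 <= sqnorm f)%E.
Proof. by apply: integral_ge0 => t _; rewrite lee_fin sqr_ge0. Qed.

Lemma L2normE f : L2norm f = (sqnorm f `^ 2^-1)%E.
Proof.
rewrite /L2norm unlock /sqnorm; congr poweR; apply: eq_integral => t _.
by rewrite abse_EFin poweR_EFin ger0_norm ?normc_ge0// powR_mulrn ?normc_ge0.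
Qed.

Lemma L2norm_lt {f} {e : R} : 0 < e -> (sqnorm f < (e ^+ 2)%:E)%E ->
  (L2norm f < e%:E)%E.
Proof.
move=> e0; rewrite L2normE; have := sqnorm_ge0 f.
case: (sqnorm f) => [r| |]//; rewrite lee_fin => r0; rewrite poweR_EFin !lte_fin => re.
by rewrite powR12_sqrt// -(ger0_norm (ltW e0)) -sqrtr_sqr ltr_sqrt// exprn_gt0.
Qed.

Lemma L2_sqnorm_lty {f} : L2 f -> (sqnorm f < +oo)%E.
Proof. by case=> _ _; rewrite L2normE => /lty_poweRy; apply. Qed.

(** A substitute for the triangle inequality: pointwise, (x + y)^2 <= 2 x^2 + 2 y^2 because (x -
    y)^2 >= 0. *)
Lemma sqnormD {f g} : cmeasurable f -> cmeasurable g ->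
  (sqnorm (fun t => (f t + g t)%R) <= 2%:E * sqnorm f + 2%:E * sqnorm g)%E.
Proof.
move=> mf mg; rewrite /sqnorm.
have msf := measurable_sqr_normc mf; have msg := measurable_sqr_normc mg.
have ge0 h (t : R) : (0 <= (normc (h t) ^+ 2)%:E)%E by rewrite lee_fin sqr_ge0.
have two h (t : R) : (0 <= 2%:E * (normc (h t) ^+ 2)%:E)%E.
  by rewrite -EFinM lee_fin mulr_ge0// sqr_ge0.
rewrite -!ge0_integralZl//; try (by move=> t _; exact: ge0).
rewrite -ge0_integralD//; try (by move=> t _; exact: two); try exact: measurable_funeM.
apply: ge0_le_integral => //.
- by move=> t _; rewrite lee_fin sqr_ge0.
- exact: (measurable_sqr_normc (cmeasurableD mf mg)).
- by apply: emeasurable_funD; exact: measurable_funeM.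
move=> t _; rewrite -!EFinM -EFinD lee_fin.
have := le_normcD (f t) (g t).
have := normc_ge0 (f t); have := normc_ge0 (g t).
have := normc_ge0 (f t + g t).
move: (normc (f t)) (normc (g t)) (normc _) => x y z z0 y0 x0 zxy.
have : z ^+ 2 <= (x + y) ^+ 2 by rewrite lerXn2r ?nnegrE// addr_ge0.
have := sqr_ge0 (x - y); rewrite !expr2; lra.
Qed.

Lemma bounded_supp_L2 {M N f} : 0 <= N -> bounded_supp M N f -> L2 f.
Proof.
move=> N0 bf; have [[mf1 mf2] _ _] := bf; split => //.
rewrite L2normE; apply: poweR_lty.
exact: le_lt_trans (bounded_supp_integral_sqr N0 bf) (ltry _).
Qed.

Definition truncation (n : nat) f (t : R) : R[i] :=
  if (normc (f t) <= n%:R) && (`|t| <= n%:R) then f t else 0.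

Lemma bounded_supp_truncation (n : nat) {f} : cmeasurable f ->
  bounded_supp n%:R n%:R (truncation n f).
Proof.
move=> mf; rewrite /truncation; split.
- apply: (cmeasurable_if _ mf (cmeasurable_cst 0)).
  apply: measurable_and; apply: measurable_fun_ler.
  + exact: measurable_normc.
  + exact: measurable_cst.
  + exact: normr_measurable.
  + exact: measurable_cst.
- by move=> t; case: ifP => [/andP[]//|_]; rewrite normc0.
- by move=> t nt; rewrite [_ <= n%:R in X in _ && X]leNgt nt andbF.
Qed.

(** Dominated convergence, with |f|^2 as the dominating function. *)
Lemma truncation_approx f (e : R) : L2 f -> 0 < e ->
  exists n, (sqnorm (fun t => (f t - truncation n f t)%R) < e%:E)%E.
Proof.
move=> Lf e0; have [mf1 mf2 _] := Lf; have mf : cmeasurable f by [].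
have mtr n : cmeasurable (fun t => f t - truncation n f t).
  have [mt _ _] := bounded_supp_truncation n mf.
  have := cmeasurableD mf (cmeasurableM (cmeasurable_cst (-1)) mt).
  by congr cmeasurable; apply/funext => t; rewrite mulN1r.
have cv : {ae mu, forall x : R, [set: R] x ->
    (normc (f x - truncation n f x) ^+ 2)%:E @[n --> \oo] --> 0%E}.
  (* Once [n] exceeds both |f(t)| and |t|, the truncation equals [f] at [t], so the sequence is
     eventually 0. *)
  apply/nearW => t _; apply: cvg_near_cst.
  near=> n; rewrite /truncation ifT ?subrr ?normc0 ?expr0n//.
  apply/andP; split; near: n; exact: nbhs_infty_ger.
have ig : mu.-integrable [set: R] (fun t => (normc (f t) ^+ 2)%:E).
  apply/integrableP; split; first exact: measurable_sqr_normc.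
  have := L2_sqnorm_lty Lf; rewrite /sqnorm.
  by under eq_integral do rewrite -[X in X%:E]ger0_norm ?sqr_ge0//.
have dom : {ae mu, forall (x : R) (n : nat), [set: R] x ->
   (`|(normc (f x - truncation n f x) ^+ 2)%:E| <= (normc (f x) ^+ 2)%:E)%E}.
  apply/nearW => t n _; rewrite abse_EFin ger0_norm ?sqr_ge0// lee_fin.
  rewrite /truncation; case: ifP => _; last by rewrite subr0.
  by rewrite subrr normc0 expr0n sqr_ge0.
have [_ _] := @dominated_convergence _ (measurableTypeR R) R mu setT measurableT
  (fun n t => (normc (f t - truncation n f t) ^+ 2)%:E) (cst 0%E)
  (fun t => (normc (f t) ^+ 2)%:E)
  (fun n => measurable_sqr_normc (mtr n)) (measurable_cst _) cv ig dom.
rewrite integral0.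
move=> /fine_cvgP[fi /cvgrPdist_lt/(_ e e0)].
(* An index is taken at which the integral is both finite and within [e] of 0; finiteness allows the
   return from [fine] to extended reals. *)
move=> H; have [n _ /(_ n (leqnn n))[]] := filterI fi H.
move=> fn; rewrite sub0r normrN => lt_e; exists n.
rewrite /sqnorm -[X in (X < _)%E](fineK fn) lte_fin.
by apply: le_lt_trans lt_e; exact: ler_norm.
Unshelve. all: by end_near.
Qed.

(** * The operator T and its effect on the Gabor transform *)

Definition gshift s f (t : R) : R[i] := (expR (2 * pi * s * t))%:C%C * f (t - s).

(** The shifted function lives on |t| <= N + |s|, where the weight is at most its value for |s| and
    the largest |t|. *)
Lemma bounded_supp_gshift {M N f} s : bounded_supp M N f ->
  bounded_supp (expR (2 * pi * `|s| * (N + `|s|)) * M) (N + `|s|) (gshift s f).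
Proof.
move=> bf; apply: bounded_suppM (expR_ge0 _) _ _ (bounded_supp_shift s bf).
  apply/cmeasurable_real/(measurableT_comp (@measurable_expR R)).
  by apply: measurable_funM.
move=> t tN; rewrite normc_real ger0_norm ?expR_ge0// ler_expR.
apply: le_trans (ler_norm _) _; rewrite !normrM.
by rewrite (ger0_norm (pi_ge0 R)) ger0_norm// ler_wpM2l// !mulr_ge0// pi_ge0.
Qed.

Definition gabor_kernel (x w t : R) : R[i] :=
  (expR (- pi * (t - x) ^+ 2))%:C%C * cexpi (- 2 * pi * t * w).

Lemma normc_gabor_kernel x w t : normc (gabor_kernel x w t) <= 1.
Proof.
rewrite normcM normc_cexpi mulr1 normc_real ger0_norm ?expR_ge0//.
by rewrite -expR0 ler_expR mulNr oppr_le0 mulr_ge0 ?pi_ge0// sqr_ge0.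
Qed.

Lemma cmeasurable_gabor_kernel x w : cmeasurable (gabor_kernel x w).
Proof.
have m1 : measurable_fun [set: R] (fun t => expR (- pi * (t - x) ^+ 2)).
  apply/(measurableT_comp (@measurable_expR R))/measurable_funM => //.
  by apply: measurable_funX; exact: measurable_addrr.
have m2 : measurable_fun [set: R] (fun t : R => - 2 * pi * t * w).
  by apply: measurable_funM => //; exact: measurable_funM.
exact: (cmeasurableM (cmeasurable_real m1) (cmeasurable_cexpi m2)).
Qed.

Lemma gaborE f x w : gabor f (x, w) =
  (2 `^ 4^-1)%:C%C * cintegral (fun t => gabor_kernel x w t * f t).
Proof.
rewrite /gabor/=; congr (_ * cintegral _); apply/funext => t.
by rewrite /gabor_kernel -mulrA mulrC.
Qed.

(* In the exponents, with t = u + s :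
   2 s t - (t - x)^2 = - (u - x)^2 + s^2 + 2 s x. *)
Lemma gabor_kernel_gshift s f x w t : cexpi (- 2 * pi * s * w) = 1 ->
  gabor_kernel x w t * gshift s f t =
  (expR (pi * s ^+ 2 + 2 * pi * s * x))%:C%C *
    (gabor_kernel x w (t - s) * f (t - s)).
Proof.
move=> per; rewrite /gabor_kernel /gshift.
have -> : - 2 * pi * t * w = - 2 * pi * s * w + - 2 * pi * (t - s) * w by ring.
rewrite cexpiD per mul1r.
move: (cexpi _) (f _) => E F.
rewrite mulrACA -[X in _ = _ * X]mulrA [RHS]mulrA -!rmorphM -!expRD.
by congr (_%:C%C * _); congr expR; ring.
Qed.

(** By [gabor_kernel_gshift] the integrand of the second term is a constant times a translate of the
    integrand of the first, and translation does not change the integral. *)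
Lemma gabor_add_gshift {M N f} (c : R[i]) s x w : bounded_supp M N f ->
  cexpi (- 2 * pi * s * w) = 1 ->
  gabor (fun t => f t + c * gshift s f t) (x, w) =
  (1 + c * (expR (pi * s ^+ 2 + 2 * pi * s * x))%:C%C) * gabor f (x, w).
Proof.
move=> bf per; rewrite !gaborE.
set r := (expR _)%:C%C.
have mk := cmeasurable_gabor_kernel x w.
have bk := bounded_suppM ler01 mk (fun t _ => normc_gabor_kernel x w t) bf.
have [mkf _ _] := bk.
have -> : (fun t => gabor_kernel x w t * (f t + c * gshift s f t)) =
    (fun t => gabor_kernel x w t * f t +
       c * r * (gabor_kernel x w (t - s) * f (t - s))).
  by apply/funext => t; rewrite mulrDr mulrCA gabor_kernel_gshift// -[c * r * _]mulrA.
have bks := bounded_supp_shift s bk.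
have bcks := bounded_suppM (normc_ge0 (c * r)) (cmeasurable_cst (c * r))
  (fun t _ => lexx _) bks.
set F := fun t => gabor_kernel x w t * f t.
have -> : cintegral (fun t => F t + c * r * F (t - s)) = (1 + c * r) * cintegral F.
  rewrite mulrDl mul1r -[in X in _ = _ + c * r * X](cintegral_shift s mkf).
  rewrite -(cintegralZ (c * r) (bounded_supp_integrable bks)).
  exact: cintegralD (bounded_supp_integrable bk) (bounded_supp_integrable bcks).
by rewrite mulrCA.
Qed.

(** * Inequivalence of the two functions, equality of their moduli, and the collar *)

(** An interval of positive length does not fit in a null set; this turns an almost-everywhere
    equality into one at a point of a chosen interval. *)
Lemma ae_itv_exists (P : R -> Prop) (a b : R) : a < b ->
  {ae mu, forall t, P t} -> exists2 t, a < t < b & P t.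
Proof.
move=> ab [A [mA A0 PA]]; apply: contrapT => nP.
have sub : `]a, b[%classic `<=` A.
  move=> t; rewrite /= in_itv/= => tab; apply: PA => Pt.
  by apply: nP; exists t.
have : (mu `]a, b[ <= mu A)%E by apply: le_measure; rewrite ?inE.
rewrite A0 lebesgue_measure_itv/= lte_fin ab -EFinB lee_fin.
by rewrite leNgt subr_gt0 ab.
Qed.

Lemma exists_small_sqr (C d : R) : 0 <= C -> 0 < d ->
  exists2 eps, 0 < eps <= 1 & eps ^+ 2 * C < d.
Proof.
move=> C0 d0; exists (Num.min 1 (d / (C + 1))).
  by rewrite lt_min ltr01 ge_min lexx/= divr_gt0// ltr_pwDr.
set m := Num.min _ _.
have m1 : m <= 1 by rewrite ge_min lexx.
have m0 : 0 < m by rewrite lt_min ltr01/= divr_gt0// ltr_pwDr.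
have : m <= d / (C + 1) by rewrite ge_min lexx orbT.
rewrite ler_pdivlMr ?ltr_pwDr// => md.
have : m ^+ 2 * C <= m * C by rewrite ler_wpM2r// expr2 ger_pMr.
by lra.
Qed.

Lemma gshift_not_phase_equiv (N s : R) (c d : R[i]) f : 0 <= N -> 0 < s ->
  c != 0 -> d != 0 -> (forall t, N < `|t| <= N + s -> f t = d) ->
  (forall t, N + s < `|t| -> f t = 0) ->
  ~ phase_equiv (fun t => f t + c * gshift s f t) (fun t => f t + - c * gshift s f t).
Proof.
move=> N0 s0 c0 d0 fd f0 [alpha ae].
(* On this interval [f] equals [d], while t - s < -(N + s) makes the shifted term vanish; the
   equality reads d = cexpi(alpha) d. *)
have [|t /andP[t1 t2] /(_ I)] := @ae_itv_exists _ (- (N + s)) (- N) _ ae.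
  by rewrite ltrN2 ltrDl.
have -> : f t = d by apply: fd; rewrite ler0_norm; lra.
rewrite /gshift (f0 (t - s)); last by rewrite ler0_norm; lra.
rewrite !mulr0 !addr0 => /esym; rewrite -[RHS]mul1r => /(mulIf d0) phase1.
(* Now [f] vanishes at [u] and u - s lies in the collar. With phase 1 the equality becomes p = -p
   for a nonzero [p]. *)
have [|u /andP[u1 u2] /(_ I)] := @ae_itv_exists _ (N + s) (N + s + s) _ ae.
  by rewrite ltrDl.
have -> : f u = 0 by apply: f0; rewrite ger0_norm; lra.
rewrite /gshift (fd (u - s)); last by rewrite ger0_norm; lra.
rewrite phase1 !add0r mul1r mulNr; set p := c * _.
have p0 : p != 0.
  rewrite !mulf_neq0//; apply/eqP => /(congr1 Re)/= /eqP.
  by rewrite gt_eqF// expR_gt0.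
move=> /eqP; rewrite -addr_eq0 -mulr2n -mulr_natl mulf_eq0 (negbTE p0) orbF.
by rewrite pnatr_eq0.
Qed.

(** The two factors from [gabor_add_gshift] are complex conjugates. *)
Lemma gabor_gshift_conj {M N f} (eps s x w : R) : bounded_supp M N f ->
  cexpi (- 2 * pi * s * w) = 1 ->
  normc (gabor (fun t => f t + (0 +i* eps)%C * gshift s f t) (x, w)) =
  normc (gabor (fun t => f t + - (0 +i* eps)%C * gshift s f t) (x, w)).
Proof.
move=> bf per; rewrite !(gabor_add_gshift _ _ _ _ bf per) !normcM; congr (_ * _).
by rewrite /=; congr Num.sqrt; ring.
Qed.

(** The strict inner bound keeps it disjoint from functions supported in |t| <= N. *)
Definition collar (N s eps t : R) : R[i] :=
  if (N < `|t|) && (`|t| <= N + s) then eps%:C%C else 0.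

Lemma bounded_supp_collar N s eps : 0 <= eps ->
  bounded_supp eps (N + s) (collar N s eps).
Proof.
move=> eps0; rewrite /collar; split.
- apply: (cmeasurable_if _ (cmeasurable_cst _) (cmeasurable_cst 0)).
  apply: measurable_and.
    by apply: measurable_fun_ltr => //; exact: normr_measurable.
  by apply: measurable_fun_ler => //; exact: normr_measurable.
- by move=> t; case: ifP => _; rewrite ?normc0// normc_real ger0_norm.
- by move=> t tN; rewrite (leNgt _ (N + s)) tN andbF.
Qed.

End complex_functions.

Theorem theorem3 (R : realType) (a : R) (ha : 0 < a) :
  dense_in_L2
    (counterexamples ([set: R] `*` range (fun k : int => a * k%:~R))).
Proof.
move=> f Lf e e0.
(* The error is split in two and [sqnormD] doubles each piece, so a quarter of e^2 is allotted to
   each. *)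
have e4 : 0 < e ^+ 2 / 4 by rewrite divr_gt0// exprn_gt0.
have [n trn] := truncation_approx f (e ^+ 2 / 4) Lf e4.
have [mf1 mf2 _] := Lf; have mf : cmeasurable f by [].
pose s := a^-1; have s0 : 0 < s by rewrite invr_gt0.
pose N : R := n%:R + s; have N0 : 0 <= N by rewrite addr_ge0// ltW.
pose N' : R := N + s; have N'0 : 0 <= N' by rewrite addr_ge0// ltW.
(* This bounds T F for every eps <= 1, since F is then bounded by n + 1; hence [K] and [C] can
   precede [eps]. *)
pose K : R := expR (2 * pi * `|s| * (N + `|s|)) * (n%:R + 1).
pose C := (1 + K) ^+ 2 * (2 * N').
have [|eps /andP[eps0 eps1] Ceps] := @exists_small_sqr _ C _ _ e4.
  by rewrite mulr_ge0 ?sqr_ge0// mulr_ge0.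
have btr := bounded_supp_truncation n mf.
have bcol := @bounded_supp_collar _ n%:R s eps (ltW eps0).
pose F t := truncation n f t + collar n%:R s eps t.
have bF : bounded_supp (n%:R + 1) N F.
  apply: bounded_suppD; first by apply: bounded_suppW btr => //; rewrite lerDl ltW.
  exact: bounded_suppW bcol.
have bTF : bounded_supp K N' (gshift s F).
  by have := bounded_supp_gshift s bF; rewrite -/K (gtr0_norm s0).
pose c : R[i] := (0 +i* eps)%C.
have nc : normc c = eps by rewrite /= expr0n add0r sqrtr_sqr gtr0_norm.
have bZ (b : R[i]) M L g : bounded_supp M L g ->
    bounded_supp (normc b * M) L (fun t => b * g t).
  exact: bounded_suppM (normc_ge0 b) (cmeasurable_cst b) (fun t _ => lexx _).
have LT b : L2 (fun t => F t + b * gshift s F t).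
  apply: (bounded_supp_L2 N'0 (bounded_suppD _ (bZ b _ _ _ bTF))).
  by apply: bounded_suppW bF => //; rewrite lerDl ltW.
exists (fun t => F t + c * gshift s F t).
  split; first exact: LT.
  exists (fun t => F t + - c * gshift s F t); split; first exact: LT.
    apply: (@gshift_not_phase_equiv _ n%:R s c eps%:C%C) => //.
    - by apply/eqP => -[]/eqP; rewrite gt_eqF.
    - by apply/eqP => -[]/eqP; rewrite gt_eqF.
    (* The truncation vanishes for |t| > n, so only the collar contributes. *)
    - move=> t tN; have /andP[t1 _] := tN.
      rewrite /F /collar tN; have [_ _ ->//] := btr.
      by rewrite add0r.
    - by have [_ _] := bF.
  move=> [x w] [_ [k _ /= <-]]; apply: (gabor_gshift_conj _ _ _ _ bF).
  (* Since s a = 1, the phase at w = a k is 2 pi (-k). *)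
  rewrite -(cexpi_int (- k)); congr cexpi; rewrite mulrNz /s.
  by rewrite -mulrA mulKf ?gt_eqF// mulrN -!mulNr.
apply: L2norm_lt => //.
(* The part of the error beyond truncation; both terms carry a factor [eps], so its squared norm is
   at most eps^2 C. *)
pose w t := -1 * collar n%:R s eps t + - c * gshift s F t.
have bw : bounded_supp (eps * (1 + K)) N' w.
  rewrite mulrDr mulr1; apply: bounded_suppD.
    have := bZ (-1) _ _ _ bcol; rewrite normcN normc1 mul1r.
    by apply: bounded_suppW => //; rewrite lerDl ltW.
  by have := bZ (- c) _ _ _ bTF; rewrite normcN nc.
have -> : (fun t => f t - (F t + c * gshift s F t)) =
    (fun t => (f t - truncation n f t) + w t).
  by apply/funext => t; rewrite /w /F; ring.
have mtr : cmeasurable (fun t => f t - truncation n f t).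
  have [mt _ _] := bZ (-1) _ _ _ btr.
  by have := cmeasurableD mf mt; under eq_fun do rewrite mulN1r.
have [mw _ _] := bw.
apply: le_lt_trans (sqnormD mtr mw) _.
have lt_w : (sqnorm w < (e ^+ 2 / 4)%:E)%E.
  apply: le_lt_trans (bounded_supp_integral_sqr N'0 bw) _.
  by rewrite lte_fin exprMn -mulrA.
have -> : (e ^+ 2)%:E = (2%:E * (e ^+ 2 / 4)%:E + 2%:E * (e ^+ 2 / 4)%:E)%E.
  by rewrite -!EFinM -EFinD; congr EFin; field.
by apply: lteD; rewrite lte_pmul2l.
Qed.
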